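(* Let $G$ be a countable infinite discrete group with identity $e$ and let $\mathcal{F}\subset\mathcal{P}(G)$ be a Furstenberg family with the Ramsey property. If $\mathcal{F}$ satisfies (P1) and (P2) and $h(\mathcal{F})$ is a nonempty closed subsemigroup of $\beta G$, then (1) for any $G$-system $(X,G)$ on a compact Hausdorff space $X$, if a point $x\in X$ is $\mathcal{F}$-recurrent, then for every neighborhood $U$ of $x$, $N(x,U)$ is an essential $\mathcal{F}$-set; (2) for any essential $\mathcal{F}$-subset $F$ of $G$, there exist a $G$-system $(X,G)$, an $\mathcal{F}$-recurrent point $x\in X$ and a neighborhood $U$ of $x$ such that $N(x,U)\subset F\cup\{e\}$.
   Context: $\mathcal{P}(G)$ is the collection of all subsets of $G$ and $\mathcal{P}_f(G)$ the collection of all nonempty finite subsets of $G$. A Furstenberg family is a collection $\mathcal{F}\subset\mathcal{P}(G)\setminus\{\emptyset\}$ such that $F\in\mathcal{F}$ and $F\subset H\subset G$ imply $H\in\mathcal{F}$. It has the Ramsey property if whenever $A\in\mathcal{F}$ and $A=A_1\cup A_2$, then $A_1\in\mathcal{F}$ or $A_2\in\mathcal{F}$. $\mathcal{F}$ satisfies (P1) if for any $A\in\mathcal{F}$ there exists a sequence $\{A_n\}_{n=1}^\infty$ in $\mathcal{P}_f(G)$ such that: $A_n\subset A$ for every $n$; $A_n\cap A_m=\emptyset$ for all $n\neq m$; and for every strictly increasing sequence $\{n_k\}_{k=1}^\infty$ in $\mathbb{N}$, $\bigcup_{k=1}^\infty A_{n_k}\in\mathcal{F}$. $\mathcal{F}$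 satisfies (P2) if for any $F\in\mathcal{F}$ and any $K\in\mathcal{P}_f(G)$ there exists $F'\subset F$ with $F'\in\mathcal{F}$ such that for any distinct $f_1,f_2\in F'\cup\{e\}$, $Kf_1\cap Kf_2=\emptyset$. $\beta G$ is the Stone-Čech compactification of $G$: the set of ultrafilters on $G$ with basis of open sets $\{p: A\in p\}$, $A\subset G$, and operation $p\cdot q=\{A\subset G:\{g\in G: g^{-1}A\in q\}\in p\}$. The hull of $\mathcal{F}$ is $h(\mathcal{F})=\{p\in\beta G: p\subset\mathcal{F}\}$. A subset $F$ of $G$ is an essential $\mathcal{F}$-set if there is $p\in h(\mathcal{F})$ with $p\cdot p=p$ and $F\in p$. A $G$-system $(X,G)$ is a compact Hausdorff space $X$ with an action of the discrete group $G$ by homeomorphisms. ''Neighborhood'' means open neighborhood. $N(x,U)=\{g\in G: gx\in U\}$. A point $x\in X$ is $\mathcal{F}$-recurrent if $N(x,U)\in\mathcal{F}$ for every neighborhood $U$ of $x$. *)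

(* Defs.v *)
From HB Require Import structures.
From mathcomp Require Import all_boot all_order.
From mathcomp Require Import all_classical topology.

Set Implicit Arguments.
Unset Strict Implicit.
Unset Printing Implicit Defensive.

Local Open Scope classical_set_scope.

Section Families.
Variable G : groupType.
Implicit Types (F : set_system G) (A H K : set G).

(* [ltrans g A] is gA and [rtrans K f] is Kf *)
Definition ltrans (g : G) A : set G := [set (g * a)%g | a in A].
Definition rtrans K (f : G) : set G := [set (k * f)%g | k in K].

Definition finite_nonempty A : Prop := finite_set A /\ A !=set0.

Definition furstenberg_family F : Prop :=
  ~ F set0 /\ forall A H, F A -> A `<=` H -> F H.

Definition ramsey_property F : Prop :=
  forall A A1 A2, F A -> A = A1 `|` A2 -> F A1 \/ F A2.

Definition property_P1 F : Prop :=
  forall A, F A -> exists A_ : nat -> set G,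
    [/\ forall n, finite_nonempty (A_ n),
        forall n, A_ n `<=` A,
        forall n m, n <> m -> A_ n `&` A_ m = set0
      & forall n_ : nat -> nat, {homo n_ : i j / (i < j)%N} ->
          F (\bigcup_k A_ (n_ k))].

Definition property_P2 F : Prop :=
  forall A K, F A -> finite_nonempty K -> exists A' : set G,
    [/\ A' `<=` A, F A'
      & forall f1 f2, (A' `|` [set 1%g]) f1 -> (A' `|` [set 1%g]) f2 ->
          f1 <> f2 -> rtrans K f1 `&` rtrans K f2 = set0].

End Families.

Record ultrafilter (T : Type) := Ultrafilter {
  ultrafilter_sets : set_system T;
  ultrafilterP : UltraFilter ultrafilter_sets }.

HB.instance Definition _ T := gen_eqMixin (ultrafilter T).
HB.instance Definition _ T := gen_choiceMixin (ultrafilter T).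

Section StoneCech.
Variable T : Type.

Definition ultrafilter_basic (A : set T) : set (ultrafilter T) :=
  [set p | ultrafilter_sets p A].

Let ultrafilter_basic_cover :
  \bigcup_(A in [set: set T]) ultrafilter_basic A = setT.
Proof.
rewrite predeqE => p; split=> // _; exists setT => //=.
by have Up := ultrafilterP p; exact: filterT.
Qed.

Let ultrafilter_basic_join (A B : set T) (p : ultrafilter T) :
  [set: set T] A -> [set: set T] B ->
  ultrafilter_basic A p -> ultrafilter_basic B p ->
  exists C, [/\ [set: set T] C, ultrafilter_basic C p &
    ultrafilter_basic C `<=` ultrafilter_basic A `&` ultrafilter_basic B].
Proof.
move=> _ _ pA pB; exists (A `&` B); split=> //.
  by have Up := ultrafilterP p; exact: filterI.
move=> q qAB; have Uq := ultrafilterP q.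
by split; apply: filterS qAB => t [].
Qed.

HB.instance Definition _ := isBaseTopological.Build (ultrafilter T)
  ultrafilter_basic_cover ultrafilter_basic_join.

End StoneCech.

Section Semigroup.
Variable G : groupType.

Definition ultrafilter_mul_sets (p q : ultrafilter G) : set_system G :=
  [set A | ultrafilter_sets p [set g | ultrafilter_sets q (ltrans g^-1%g A)]].

Lemma ltransVE (g : G) (A : set G) : ltrans g^-1%g A = [set h | A (g * h)%g].
Proof.
rewrite predeqE => h; split=> [[a Aa <-]|Agh] /=; first by rewrite mulVKg.
by exists (g * h)%g => //; rewrite mulKg.
Qed.

Lemma ultrafilter_mul_ultra (p q : ultrafilter G) :
  UltraFilter (ultrafilter_mul_sets p q).
Proof.
have Up := ultrafilterP p; have Uq := ultrafilterP q.
have FF : ProperFilter (ultrafilter_mul_sets p q).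
  apply: Build_ProperFilter_ex.
    move=> A pA; have [g /=] := @filter_ex _ (ultrafilter_sets p) _ _ pA.
    by rewrite ltransVE => /filter_ex[h]; exists (g * h)%g.
  split.
  - apply: (@filterS _ (ultrafilter_sets p) _ _ _ _ filterT) => g _ /=.
    by rewrite ltransVE; exact: filterT.
  - move=> A B; rewrite /ultrafilter_mul_sets /= => pA pB.
    apply: (@filterS _ (ultrafilter_sets p) _ _ _ _ (filterI pA pB)) => g /= [].
    by rewrite !ltransVE => qA qB; apply: filterS (filterI qA qB).
  - move=> A B AB; apply: (@filterS _ (ultrafilter_sets p)) => g /=; rewrite !ltransVE.
    by apply: filterS => h; exact: AB.
split=> // H HF sH; rewrite predeqE => A; split=> [HA|]; last exact: sH.
have [//|pN] :=
  in_ultra_setVsetC [set g | ultrafilter_sets q (ltrans g^-1%g A)] Up.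
suff /sH HN : ultrafilter_mul_sets p q (~` A).
  have HAN : H (A `&` ~` A) by exact: filterI.
  by have /filter_ex[x []] := HAN.
apply: (@filterS _ (ultrafilter_sets p) _ _ _ _ pN) => g /=; rewrite !ltransVE => nq.
by have [//|] := in_ultra_setVsetC [set h | A (g * h)%g] Uq.
Qed.

Definition ultrafilter_mul (p q : ultrafilter G) : ultrafilter G :=
  Ultrafilter (ultrafilter_mul_ultra p q).

Definition hull (F : set_system G) : set (ultrafilter G) :=
  [set p | ultrafilter_sets p `<=` F].

Definition nonempty_closed_subsemigroup (S : set (ultrafilter G)) : Prop :=
  [/\ S !=set0, closed S & forall p q, S p -> S q -> S (ultrafilter_mul p q)].

Definition essential (F : set_system G) (A : set G) : Prop :=
  exists p : ultrafilter G, [/\ hull F p, ultrafilter_mul p p = p & ultrafilter_sets p A].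

End Semigroup.

(* The maps [gsystem_act g] are homeomorphisms: the inverse of
   [gsystem_act g] is the continuous map [gsystem_act g^-1]. *)
Record gsystem (G : groupType) := Gsystem {
  gsystem_space :> topologicalType;
  gsystem_act : G -> gsystem_space -> gsystem_space;
  gsystem_compact : compact [set: gsystem_space];
  gsystem_hausdorff : hausdorff_space gsystem_space;
  gsystem_act1 : forall x, gsystem_act 1%g x = x;
  gsystem_actM : forall g h x,
    gsystem_act (g * h)%g x = gsystem_act g (gsystem_act h x);
  gsystem_act_continuous : forall g, continuous (gsystem_act g) }.

Section Recurrence.
Variables (G : groupType) (X : gsystem G).

Definition return_times (x : X) (U : set X) : set G :=
  [set g | U (gsystem_act g x)].

Definition recurrent (F : set_system G) (x : X) : Prop :=
  forall U : set X, open_nbhs x U -> F (return_times x U).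

End Recurrence.

(* Main.v *)
Require Import Defs.
From HB Require Import structures.
From mathcomp Require Import all_boot all_order.
From mathcomp Require Import all_classical topology.

Set Implicit Arguments.
Unset Strict Implicit.
Unset Printing Implicit Defensive.

Local Open Scope classical_set_scope.

(** The theorem translates between recurrence in a system and idempotents of
    [ultrafilter G].

    A point [x] is moved back to itself along an ultrafilter [p] when [p]
    contains every set of return times of [x].  The ultrafilters of the hull
    with this property form a compact subsemigroup
    ([recurrent_return_essential]): closure under products holds because
    translating a set of return times of [x] by one of its own elements gives
    again the return times to a neighborhood of [x], and nonemptiness because,
    by the Ramsey property, a filter contained in [F] extends to an ultrafilter
    contained in [F] ([ramsey_filter_sub_hull]).  By Ellis and Numakura
    ([ellis_numakura]) there is an idempotent in it, which witnesses that all
    these return sets are essential.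

    Conversely, let [p] be an idempotent of the hull containing [A].  In the
    shift on the cube of boolean functions on [G], the indicator of a set [B]
    returns to the cylinder at 1 exactly at the elements of [B], and it is
    recurrent as soon as, for every finite [K], the set of [g] such that [B]
    looks the same on [K] and on [Kg] belongs to [F] ([shift_recurrent]).
    It remains to find such a [B] containing 1 inside [A] with 1 added
    ([sparse_words_exist]).  Idempotence lets [A] be replaced by a subset [S]
    in [p] such that [g^-1 S] is in [p] for all [g] in [S]
    ([idempotent_star]), so that words can be extended on the right without
    leaving [S].  The set [B] is grown in finite stages [P n], inside finite
    windows [W n] which exhaust [G].  Once [P n] and [W n] are known, (P2) and
    (P1) give a sequence of finite blocks whose elements may be appended to the
    words of [P n], whose elements are separated by [W n], and which has the
    property that the union of any subsequence is in [F]
    ([admissible_blocks_exist]).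

    Unions of blocks taken from different sequences are under no control, so
    each sequence must be used infinitely often: at stage [m] the next block
    comes from the sequence created at stage [t], where [t] takes each value
    infinitely often, and only the words of [P t] are extended by it.  The block
    [H] is chosen so far out in its sequence that [W t * H] is disjoint from
    [W m].  Then, for [g] in [H] and [k] in [W t], the element [kg] can enter
    [B] at stage [m] only, as [bh] with [b] in [P t] and [h] in [H];
    separation gives [h = g], whence [k = b] is in [B].  So every element of the
    block is a return time for the window [W t], and these blocks together form
    a set of [F]. *)

(** * Idempotents in compact right topological semigroups *)

Lemma compact_chain_bigcap (T : topologicalType) (C : set (set T)) :
  C !=set0 -> total_on C subset ->
  (forall D, C D -> [/\ compact D, closed D & D !=set0]) ->
  \bigcap_(D in C) D !=set0.
Proof.
move=> C0 totC CP; have [D0 CD0] := C0.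
have FF : ProperFilter (filter_from C id).
  apply: filter_from_proper => [|D CD]; last by have [] := CP D CD.
  apply: filter_from_filter => // D E CD CE.
  have [DE|ED] := totC D E CD CE.
    by exists D => // x Dx; split=> //; exact: DE.
  by exists E => // x Ex; split=> //; exact: ED.
have [cD0 _ _] := CP _ CD0.
have [|x [_ clx]] := cD0 _ FF; first by exists D0.
exists x => D CD; have [_ clD _] := CP _ CD.
by apply: clD => U Ux; apply: clx => //; exists D.
Qed.

Section Ellis.
Variables (T : topologicalType) (mul : T -> T -> T).
Hypotheses (hausT : hausdorff_space T) (mulA : associative mul).
Hypothesis mul_continuous : forall s, continuous (mul^~ s).

Let compact_subsemigroup (D : set T) :=
  [/\ compact D, D !=set0 & forall a b, D a -> D b -> D (mul a b)].

Lemma minimal_compact_subsemigroup (S : set T) : compact_subsemigroup S ->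
  exists D, [/\ compact_subsemigroup D, D `<=` S &
    forall E, compact_subsemigroup E -> E `<=` D -> E = D].
Proof.
move=> cS.
(* Zorn's lemma is available for maximal sets, so the subsemigroups are
   represented by complements in [S]: the empty set stands for [S] itself. *)
have [C Ctot|U [cU maxU]] := @Zorn_bigcup _
    [set U : set T | compact_subsemigroup (S `\` U)].
  move=> totC; have [C0|/set0P[U0 CU0]] := eqVneq C set0.
    by rewrite /= C0 bigcup_set0 setD0.
  have clD U : C U -> closed (S `\` U).
    by case/Ctot => cU _ _; exact: compact_closed.
  have SE : S `\` \bigcup_(U in C) U = \bigcap_(D in [set S `\` U | U in C]) D.
    rewrite predeqE => x; split=> [[Sx nUx] _ [U CU <-]|xD].
      by split=> // Ux; apply: nUx; exists U.
    have [Sx _] : (S `\` U0) x by apply: xD; exists U0.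
    by split=> // -[U CU Ux]; have [] : (S `\` U) x by apply: xD; exists U.
  split.
  - rewrite SE; have [SU0 _ _] := Ctot _ CU0.
    apply: (@subclosed_compact _ _ (S `\` U0)) => //.
      by apply: closed_bigI => _ [U CU <-]; exact: clD.
    by apply: bigcap_inf; exists U0.
  - rewrite SE; apply: compact_chain_bigcap.
    + by exists (S `\` U0), U0.
    + move=> _ _ [U CU <-] [V CV <-].
      by have [UV|VU] := totC U V CU CV; [right|left]; apply: setDS.
    + by move=> _ [U CU <-]; have := clD _ CU; case: (Ctot _ CU).
  - rewrite SE => a b Da Db _ [U CU <-].
    by have [_ _] := Ctot _ CU; apply; [apply: Da|apply: Db]; exists U.
exists (S `\` U); split=> // E cE ED.
apply/seteqP; split=> // x [Sx nUx]; apply: contrapT => nEx.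
apply: (maxU (~` E)) => /=.
  split=> [y Uy Ey|CEU]; first by have [_] := ED y Ey; apply.
  exact/nUx/CEU.
by rewrite setDE setCK setIidr// => y /ED[].
Qed.

(** In a minimal compact subsemigroup [D], both [D s] and the set of [t] in [D]
    with [t s = s] are compact subsemigroups, hence equal to [D]; the first
    equality shows that the second set is nonempty. *)
Lemma ellis_numakura (S : set T) : compact_subsemigroup S ->
  exists2 s, S s & mul s s = s.
Proof.
move=> /minimal_compact_subsemigroup[D [[cD [s Ds] mD] DS minD]].
have imD : (mul^~ s) @` D = D.
  apply: minD; last by move=> _ [t Dt <-]; exact: mD.
  split; [|by exists (mul s s), s|].
    by apply: continuous_compact => //; apply: continuous_subspaceT.
  move=> _ _ [a Da <-] [b Db <-]; exists (mul (mul a s) b); last by rewrite !mulA.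
  by apply: (mD) => //; exact: (mD).
have stabD : D `&` [set t | mul t s = s] = D.
  apply: minD; last exact: subIsetl.
  split.
  - apply: compact_closedI => //.
    apply: ((continuous_closedP (mul^~ s)).1 (@mul_continuous s) [set s]).
    exact/accessible_closed_set1/hausdorff_accessible.
  - by have [t Dt ts] : ((mul^~ s) @` D) s; [rewrite imD|exists t].
  - move=> a b [Da /= as_] [Db /= bs]; split; first exact: mD.
    by rewrite /= -mulA bs.
exists s; first exact: DS.
by have [] : (D `&` [set t | mul t s = s]) s by rewrite stabD.
Qed.
End Ellis.

(** * The space of ultrafilters *)

Section UltrafilterSpace.
Variable T : Type.
Implicit Types (p q : ultrafilter T) (A B : set T).

Lemma ultrafilter_ext p q : ultrafilter_sets p = ultrafilter_sets q -> p = q.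
Proof.
case: p q => [P UP] [Q UQ] /= PQ; move: UQ; rewrite -PQ => UQ.
by rewrite (Prop_irrelevance UP UQ).
Qed.

Lemma ultrafilter_sub_eq p q : ultrafilter_sets p `<=` ultrafilter_sets q -> p = q.
Proof.
move=> pq; have Up := ultrafilterP p; have Uq := ultrafilterP q.
by apply/ultrafilter_ext; exact/esym/(@max_filter _ _ Up _ _ pq).
Qed.

Lemma ultrafilter_setC p A : ultrafilter_sets p (~` A) <-> ~ ultrafilter_sets p A.
Proof.
have Up := ultrafilterP p; split=> [pnA pA|npA].
  by have [x []] := @filter_ex _ _ _ _ (filterI pA pnA).
by have [] := in_ultra_setVsetC A Up.
Qed.

Lemma open_ultrafilter_basic A : open (ultrafilter_basic A).
Proof.
by exists [set A] => //; exact: bigcup_set1.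
Qed.

Lemma closed_ultrafilter_basic A : closed (ultrafilter_basic A).
Proof.
have -> : ultrafilter_basic A = ~` ultrafilter_basic (~` A).
  rewrite predeqE => p; rewrite /ultrafilter_basic /=.
  by rewrite -[X in X <-> _]notK ultrafilter_setC.
exact/open_closedC/open_ultrafilter_basic.
Qed.

Lemma nbhs_ultrafilterE p (U : set (ultrafilter T)) :
  nbhs p U -> exists2 A, ultrafilter_sets p A & ultrafilter_basic A `<=` U.
Proof.
rewrite nbhsE => -[V [[D _ VE] Vp] VU].
move: Vp; rewrite -VE => -[A DA pA]; exists A => // q qA.
by apply: VU; rewrite -VE; exists A.
Qed.

(** An ultrafilter [U] on the space converges to the ultrafilter of those [A]
    for which [U] contains the basic set of [A]. *)
Lemma compact_ultrafilter : compact [set: ultrafilter T].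
Proof.
rewrite compact_ultra => U UU _.
have Ubig : UltraFilter [set A | U (ultrafilter_basic A)].
  have PU : ProperFilter [set A | U (ultrafilter_basic A)].
    apply: Build_ProperFilter_ex.
      move=> A UA; have [p pA] := @filter_ex _ U _ _ UA; have Up := ultrafilterP p.
      exact: filter_ex pA.
    split.
    - apply: (@filterS _ U _ _ _ _ filterT) => p _.
      by have Up := ultrafilterP p; exact: filterT.
    - move=> A B UA UB.
      apply: (@filterS _ U _ _ _ _ (@filterI _ U _ _ _ UA UB)) => p [pA pB].
      by have Up := ultrafilterP p; exact: filterI.
    - move=> A B AB; apply: (@filterS _ U) => p; have Up := ultrafilterP p.
      exact: filterS AB.
  split=> // H HF UH; apply/seteqP; split=> // A HA.
  have [//|UnA] := in_ultra_setVsetC (ultrafilter_basic A) UU.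
  have /UH HnA : U (ultrafilter_basic (~` A)).
    by apply: (@filterS _ U _ _ _ _ UnA) => p; rewrite /= -ultrafilter_setC.
  by have [x []] := @filter_ex _ _ _ _ (filterI HA HnA).
exists (Ultrafilter Ubig); split=> // V /nbhs_ultrafilterE[A UA AV].
exact: (@filterS _ U _ _ _ AV UA).
Qed.

Lemma hausdorff_ultrafilter : hausdorff_space (ultrafilter T).
Proof.
move=> p q pq; apply: ultrafilter_sub_eq => A pA.
apply: contrapT => /ultrafilter_setC qA.
have oP : nbhs p (ultrafilter_basic A).
  by apply: open_nbhs_nbhs; split=> //; exact: open_ultrafilter_basic.
have oQ : nbhs q (ultrafilter_basic (~` A)).
  by apply: open_nbhs_nbhs; split=> //; exact: open_ultrafilter_basic.
by have [r [rA /ultrafilter_setC]] := pq _ _ oP oQ.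
Qed.

End UltrafilterSpace.

(** * Recurrence gives essential sets *)

Section Hull.
Variable G : groupType.
Implicit Types (p q r : ultrafilter G).

Lemma ultrafilter_mulA : associative (@ultrafilter_mul G).
Proof.
move=> p q r; apply: ultrafilter_ext; rewrite predeqE => A.
rewrite /= /ultrafilter_mul_sets /=.
have -> : [set g | ultrafilter_sets q
      [set h | ultrafilter_sets r (ltrans h^-1%g (ltrans g^-1%g A))]] =
    [set g | ultrafilter_sets q
      (ltrans g^-1%g [set k | ultrafilter_sets r (ltrans k^-1%g A)])].
  rewrite predeqE => g /=; rewrite (ltransVE g [set k | _]) /=.
  have E h : ltrans h^-1%g (ltrans g^-1%g A) = ltrans (g * h)^-1%g A.
    by rewrite !ltransVE predeqE => k /=; rewrite mulgA.
  by have -> : [set h | ultrafilter_sets r (ltrans h^-1%g (ltrans g^-1%g A))] =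
    [set h | ultrafilter_sets r (ltrans (g * h)^-1%g A)]
    by rewrite predeqE => h /=; rewrite E.
by [].
Qed.

Lemma ultrafilter_mul_continuous q : continuous ((@ultrafilter_mul G)^~ q).
Proof.
move=> p U /nbhs_ultrafilterE[A pqA AU].
suff : nbhs p (ultrafilter_basic [set g | ultrafilter_sets q (ltrans g^-1%g A)]).
  by apply: filterS => r rA; apply: AU.
by apply: open_nbhs_nbhs; split=> //; exact: open_ultrafilter_basic.
Qed.

(** By the Ramsey property the sets whose complement is not in [F] form a
    filter, and they meet every set of [F].  An ultrafilter containing them
    together with [FB] contains no set outside [F], since it contains the
    complements of those sets. *)
Lemma ramsey_filter_sub_hull (F FB : set_system G) :
  furstenberg_family F -> ramsey_property F -> Filter FB -> FB `<=` F ->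
  exists p, hull F p /\ FB `<=` ultrafilter_sets p.
Proof.
move=> [F0 FS] FR FFB FBF.
pose H := [set A : set G | exists B N, [/\ FB B, ~ F (~` N) & B `&` N `<=` A]].
have HF : ProperFilter H.
  apply: Build_ProperFilter_ex.
    move=> A [B [N [FBB nFN BNA]]]; apply: contrapT => nA.
    apply: nFN; apply: FS (FBF _ FBB) _ => x Bx Nx.
    by apply: nA; exists x; exact: BNA.
  split.
  - by exists setT, setT; split=> //; [exact: filterT|rewrite setCT].
  - move=> A A' [B [N [FBB nFN BN]]] [B' [N' [FBB' nFN' BN']]].
    exists (B `&` B'), (N `&` N'); split; first exact: filterI.
      rewrite setCI => FNN; have [] := FR _ _ _ FNN erefl; first exact: nFN.
      exact: nFN'.
    by move=> x [[Bx B'x] [Nx N'x]]; split; [apply: BN|apply: BN'].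
  - move=> A A' AA' [B [N [FBB nFN BNA]]]; exists B, N; split=> //.
    exact: subset_trans AA'.
have [U [UU HU]] := ultraFilterLemma HF.
exists (Ultrafilter UU); split=> [A UA|B FBB] /=; last first.
  by apply: HU; exists B, setT; split=> //; rewrite setCT.
apply: contrapT => nFA.
have UnA : U (~` A).
  by apply: HU; exists setT, (~` A); split; [exact: filterT|rewrite setCK|].
by have [x []] := @filter_ex _ _ _ _ (filterI UA UnA).
Qed.
End Hull.

(** The compact subsemigroup is the set [S] of the ultrafilters of the hull along
    which [x] returns to itself; the choice of [U] does not affect it, so that
    one idempotent serves all neighborhoods. *)
Lemma recurrent_return_essential (G : groupType) (F : set_system G)
    (X : gsystem G) (x : X) (U : set X) :
  furstenberg_family F -> ramsey_property F ->
  nonempty_closed_subsemigroup (hull F) ->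
  recurrent F x -> open_nbhs x U -> essential F (return_times x U).
Proof.
move=> Ffam FR [_ clF mulF] xrec xU.
pose S := hull F `&` \bigcap_(V in open_nbhs x) ultrafilter_basic (return_times x V).
pose R := filter_from (open_nbhs x) (return_times x).
have RF : Filter R.
  apply: filter_from_filter; first by exists U.
  move=> V W xV xW; exists (V `&` W) => //; exact: open_nbhsI.
have [|p [Fp Rp]] := @ramsey_filter_sub_hull G F R Ffam FR RF.
  by move=> A [V xV VA]; apply: Ffam.2 VA; exact: xrec.
have [||||q [Fq qx] qq] := @ellis_numakura _ (@ultrafilter_mul G) _ _ _ S.
- exact: hausdorff_ultrafilter.
- exact: ultrafilter_mulA.
- exact: ultrafilter_mul_continuous.
- split; last 1 first.
  + move=> q r [Fq qx] [Fr rx]; split; first exact: mulF.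
    move=> V xV; have Uq := ultrafilterP q.
    apply: filterS (qx _ xV) => g Vg /=.
    suff -> : ltrans g^-1%g (return_times x V) =
        return_times x (@gsystem_act _ X g @^-1` V).
      apply: rx; case: xV => oV Vx; split=> //.
      by apply: open_comp => // y _; exact: gsystem_act_continuous.
    by rewrite ltransVE predeqE => h; rewrite /return_times /= gsystem_actM.
  + apply: (@subclosed_compact _ _ setT) => //; last exact: compact_ultrafilter.
    apply: closedI => //; apply: closed_bigI => V _; exact: closed_ultrafilter_basic.
  + by exists p; split=> // V xV; apply: Rp; exists V.
by exists q; split=> //; exact: qx.
Qed.

(** * Finite choices and recursion on histories *)

Lemma filter_finite_bigcap (T I : Type) (Phi : set_system T) (L : set I)
    (E : I -> set T) :
  Filter Phi -> finite_set L -> (forall i, L i -> Phi (E i)) ->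
  Phi (\bigcap_(i in L) E i).
Proof.
move=> PhiF; elim/Pchoice : I => I in L E *.
move=> /finite_fsetP[D ->] PhiE; apply: filter_bigI => i iD.
exact: PhiE.
Qed.

Lemma course_of_values (T : Type) (step : seq T -> T) :
  exists f : nat -> T, forall n, f n = step (mkseq f n).
Proof.
pose h n := iter n (fun s => rcons s (step s)) [::].
exists (fun n => step (h n)) => n; congr step.
by elim: n => // n IHn; rewrite mkseqS -IHn.
Qed.

Lemma disjoint_sequence_escapes (T : Type) (D : nat -> set T) (L : set T) :
  (forall i j, i <> j -> D i `&` D j = set0) -> finite_set L ->
  \forall j \near \oo, D j `&` L = set0.
Proof.
move=> disjD finL.
have : \forall j \near \oo, (\bigcap_(x in L) [set j | ~ D j x]) j.
  apply: (@filter_finite_bigcap _ _ \oo L (fun x => [set j | ~ D j x]) _ finL).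
  move=> x _.
  have [[i Dix]|nD] := pselect (exists i, D i x); last first.
    by exists 0 => // j _ Djx; apply: nD; exists j.
  exists i.+1 => // j /= ij Djx.
  suff : (D i `&` D j) x by rewrite disjD // => ij'; rewrite ij' ltnn in ij.
  by [].
by apply: filterS => j DL; rewrite predeqE => x; split=> // -[Djx /DL].
Qed.

Lemma countable_enumeration (T : Type) (x0 : T) : countable [set: T] ->
  exists e : nat -> T, forall x, exists n, e n = x.
Proof.
move=> /countable_injP[f finj].
have /choice[e eE] : forall n, exists y, forall x, f x = n -> y = x.
  move=> n.
  have [[y fy]|nf] := pselect (exists y, f y = n); last first.
    by exists x0 => x fx; case: nf; exists x.
  by exists y => x fx; apply: finj; rewrite ?inE// fy.
by exists e => x; exists (f x); exact: eE.
Qed.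

(** * Blocks given by an idempotent *)

Section Blocks.
Variable G : groupType.
Implicit Types (F : set_system G) (A K P S W : set G) (p : ultrafilter G).

Definition setmul A K : set G := [set (a * k)%g | a in A & k in K].

Lemma finite_setmul A K : finite_set A -> finite_set K -> finite_set (setmul A K).
Proof. exact: finite_image2. Qed.

(** The data that (P1) and (P2) provide at a stage with words [P] and window [W]:
    the second clause lets every word be extended by every element of a block,
    and the fourth one lets an element of a block be recovered from its product
    with an element of the window. *)
Definition admissible_blocks F S P W (D : nat -> set G) : Prop :=
  [/\ forall j, finite_set (D j),
      forall j, setmul P (D j) `<=` S,
      forall i j, i <> j -> D i `&` D j = set0,
      forall j g g' k k', D j g -> D j g' -> W k -> W k' ->
        (k * g = k' * g')%g -> g = g'
    & forall n_ : nat -> nat, {homo n_ : i j / (i < j)%N} ->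
        F (\bigcup_k D (n_ k))].

(** These are the words that [p]-almost every element extends on the right to an
    element of [S]. *)
Definition right_mover p S : set G :=
  [set b | ultrafilter_sets p (ltrans b^-1%g S)].

(** The common right extensions of the words of [P] form a set of [p], hence of
    [F]; (P2) thins it out to separate its elements by [W], and (P1) cuts blocks
    out of what remains.  The thinned set need not be in [p]. *)
Lemma admissible_blocks_exist F p S P W :
  property_P1 F -> property_P2 F -> hull F p ->
  finite_set P -> P `<=` right_mover p S -> finite_nonempty W ->
  exists D, admissible_blocks F S P W D.
Proof.
move=> F1 F2 Fp finP PS finW; have Up := ultrafilterP p.
pose C := \bigcap_(b in P) ltrans b^-1%g S.
have FC : F C.
  by apply: Fp; apply: (@filter_finite_bigcap _ _ (ultrafilter_sets p)).
have [C' [C'C FC' sepC']] := F2 _ _ FC finW.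
have [D [finD DC' disjD FD]] := F1 _ FC'.
exists D; split=> //.
- by move=> j; have [] := finD j.
- move=> j _ [b Pb [g Dg <-]]; have := C'C _ (DC' _ _ Dg) _ Pb.
  by rewrite ltransVE.
- move=> j g g' k k' Dg Dg' Wk Wk' kg; apply: contrapT => gg'.
  have : (rtrans W g `&` rtrans W g') (k * g)%g.
    by split; [exists k|exists k'].
  by rewrite (sepC' g g' (or_introl (DC' _ _ Dg)) (or_introl (DC' _ _ Dg'))).
Qed.

(** Since [p] is idempotent, the elements of [A] that are right movers for [A]
    form a set of [p], and they are right movers for that same set. *)
Lemma idempotent_star p A : ultrafilter_mul p p = p -> ultrafilter_sets p A ->
  exists S, [/\ S `<=` A, ultrafilter_sets p S & S `<=` right_mover p S].
Proof.
move=> pp pA; have Up := ultrafilterP p.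
have ppE C : ultrafilter_sets p C ->
    ultrafilter_sets p [set g | ultrafilter_sets p (ltrans g^-1%g C)].
  by move=> pC; have : ultrafilter_sets (ultrafilter_mul p p) C by rewrite pp.
pose S := A `&` [set g | ultrafilter_sets p (ltrans g^-1%g A)].
exists S; split; [exact: subIsetl|exact: filterI (ppE _ pA)|].
move=> g [_ pgA]; rewrite /right_mover /= ltransVE /=.
apply: filterS (filterI pgA (ppE _ pgA)) => h /=.
rewrite ltransVE /= => -[Agh]; rewrite !ltransVE /=.
move=> pgh; split=> //=; rewrite ltransVE.
suff <- : [set k | A (g * (h * k))%g] = [set k | A (g * h * k)%g] by [].
by rewrite predeqE => k /=; rewrite mulgA.
Qed.

(** * Growing the words inside the windows *)

(** [M] is to be thought of as the right movers for [S]; the blocks for all pairs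
    of words and window are chosen beforehand, and [e] enumerates [G]. *)
Section Construction.
Variables (F : set_system G) (S M : set G) (e : nat -> G).
Variable blocks : set G -> set G -> nat -> set G.
Hypothesis M1 : M 1%g.
Hypothesis SM : S `<=` M.
Hypothesis blocksP : forall P W, finite_set P -> P `<=` M -> finite_nonempty W ->
  admissible_blocks F S P W (blocks P W).

(** A schedule taking every value infinitely often, and never a future one. *)
Definition stage_type (n : nat) := logn 2 n.+1.

Lemma stage_type_le n : (stage_type n <= n)%N.
Proof. by rewrite -ltnS ltn_logl. Qed.

(** The first requirement makes the indices used for one sequence of blocks
    strictly increasing, as (P1) demands; the second one makes all the products
    of this stage new. *)
Definition next_index (j : nat) (D : nat -> set G) (V W : set G) : nat :=
  xget 0 [set i | (j < i)%N /\ setmul V (D i) `&` W = set0].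

(** The history [h] lists, for each stage, the last block index used, the words
    and the window; the words and window of an earlier stage are needed to know
    from which sequence the next block is taken and which words it extends. *)
Definition step (h : seq (nat * (set G * set G))) : nat * (set G * set G) :=
  if size h is n.+1 then
    let x0 := (0, (set0, set0)) in
    let: (j, (P, W)) := nth x0 h n in
    let: (_, (V, U)) := nth x0 h (stage_type n) in
    let D := blocks V U in let i := next_index j D U W in
    (i, (P `|` setmul V (D i), W `|` setmul U (D i) `|` [set e n]))
  else (0, ([set 1%g], [set 1%g])).

(** Since the blocks of a sequence are disjoint and the window is finite, all
    but finitely many of them satisfy the requirements of [next_index]. *)
Lemma words_windows_exist : exists (j : nat -> nat) (P W : nat -> set G),
  let H n := blocks (P (stage_type n)) (W (stage_type n)) (j n.+1) in
  [/\ P 0 = [set 1%g] /\ W 0 = [set 1%g],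
      forall n, P n.+1 = P n `|` setmul (P (stage_type n)) (H n),
      forall n, W n.+1 = W n `|` setmul (W (stage_type n)) (H n) `|` [set e n],
      forall n, (j n < j n.+1)%N
    & forall n, setmul (W (stage_type n)) (H n) `&` W n = set0] /\
  forall n, [/\ finite_set (P n), finite_set (W n), P n `<=` M & W n 1%g].
Proof.
have [f fE] := @course_of_values _ step.
exists (fst \o f), (fun n => (f n).2.1), (fun n => (f n).2.2) => H.
have f0 : f 0 = (0, ([set 1%g], [set 1%g])) by rewrite fE.
have fS n : f n.+1 = ((f n.+1).1,
    ((f n).2.1 `|` setmul (f (stage_type n)).2.1 (H n),
     (f n).2.2 `|` setmul (f (stage_type n)).2.2 (H n) `|` [set e n])) /\
    (f n.+1).1 = next_index (f n).1
      (blocks (f (stage_type n)).2.1 (f (stage_type n)).2.2)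
      (f (stage_type n)).2.2 (f n).2.2.
  suff E : f n.+1 = let: i := next_index (f n).1
      (blocks (f (stage_type n)).2.1 (f (stage_type n)).2.2)
      (f (stage_type n)).2.2 (f n).2.2 in
    let K := blocks (f (stage_type n)).2.1 (f (stage_type n)).2.2 i in
    (i, ((f n).2.1 `|` setmul (f (stage_type n)).2.1 K,
     (f n).2.2 `|` setmul (f (stage_type n)).2.2 K `|` [set e n])).
    by rewrite /H /= E.
  rewrite fE /step size_mkseq !nth_mkseq ?ltnS ?stage_type_le //.
  by case: (f n) => i [P W]; case: (f (stage_type n)) => j [V U].
have inv n : [/\ finite_set (f n).2.1, finite_set (f n).2.2,
    (f n).2.1 `<=` M & (f n).2.2 1%g].
  elim/ltn_ind: n => -[|n] IHn.
    by rewrite f0 /=; split=> // _ ->.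
  have [finP finW PM W1] := IHn n (ltnSn n).
  have [finV finU VM U1] := IHn _ (stage_type_le n).
  have [|finD DS _ _ _] := @blocksP _ (f (stage_type n)).2.2 finV VM.
    by split=> //; exists 1%g.
  rewrite (fS n).1 /=; split.
  - by rewrite finite_setU; split=> //; apply: finite_setmul => //; exact: finD.
  - rewrite !finite_setU; do 2?split=> //; apply: finite_setmul => //; exact: finD.
  - by rewrite subUset; split=> // g /DS/SM.
  - by left; left.
have nextP n : ((f n).1 < (f n.+1).1)%N /\
    setmul (f (stage_type n)).2.2 (H n) `&` (f n).2.2 = set0.
  rewrite /H /= (fS n).2.
  have [finP finW PM W1] := inv n.
  have [finV finU VM U1] := inv (stage_type n).
  have [|finD DS disjD _ _] := @blocksP _ (f (stage_type n)).2.2 finV VM.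
    by split=> //; exists 1%g.
  rewrite /next_index; set D := blocks _ _ in disjD *.
  case: xgetP => [i _ //|nextN]; exfalso.
  (* [U D] meets [W] only if [D] meets the finite set of the [u^-1 w]. *)
  pose L := [set (u^-1 * w)%g | u in (f (stage_type n)).2.2 & w in (f n).2.2].
  have [N _ NL] : \forall j \near \oo, D j `&` L = set0.
    by apply: disjoint_sequence_escapes => //; exact: finite_image2.
  apply: (nextN (maxn N (f n).1.+1)); split; first by rewrite leq_max leqnn orbT.
  rewrite predeqE => x; split=> // -[[u Uu [g Dg <-]] Wug].
  have : (D (maxn N (f n).1.+1) `&` L) g.
    by split=> //; exists u => //; exists (u * g)%g => //; rewrite mulKg.
  by rewrite NL //= leq_max leqnn.
split=> //; split=> /= [|n|n|n|n].
- by rewrite f0.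
- by rewrite (fS n).1.
- by rewrite (fS n).1.
- by have [] := nextP n.
- by have [] := nextP n.
Qed.

(** If [K] is contained in the window [W n], the return times for [K] contain the
    blocks of all the stages of type [n].  These blocks form a subsequence of
    the [n]-th sequence, so their union is in [F]. *)
Lemma sparse_words_exist : (forall g, exists n, e n = g) ->
  (forall C C', F C -> C `<=` C' -> F C') -> exists B : set G,
  [/\ B 1%g, B `<=` S `|` [set 1%g]
    & forall K, finite_set K -> F [set g | forall k, K k -> B (k * g)%g <-> B k]].
Proof.
move=> e_surj Fup; have [j [P [W]]] := words_windows_exist.
set H := fun n => _ => -[[[P0 W0] PS WS jS freshH] inv].
have Pmono m n : (m <= n)%N -> P m `<=` P n.
  elim: n => [|n IHn]; first by rewrite leqn0 => /eqP ->.
  rewrite leq_eqVlt => /predU1P[-> //|/IHn mn]; rewrite PS => g /mn; by left.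
have Wmono m n : (m <= n)%N -> W m `<=` W n.
  elim: n => [|n IHn]; first by rewrite leqn0 => /eqP ->.
  rewrite leq_eqVlt => /predU1P[-> //|/IHn mn]; rewrite WS => g /mn; by left; left.
have PW n : P n `<=` W n.
  elim/ltn_ind: n => -[|n] IHn; first by rewrite P0 W0.
  rewrite PS WS => g [/IHn Wg|[b Pb [h Hh <-]]]; first by left; left; exact: Wg.
  by left; right; exists b; [apply: IHn => //; rewrite ltnS stage_type_le|exists h].
have adm n : admissible_blocks F S (P n) (W n) (blocks (P n) (W n)).
  by have [finP finW PM W1] := inv n; apply: blocksP => //; split=> //; exists 1%g.
pose B := \bigcup_n P n.
(* A word created after stage [n] avoids the window of its own stage, which
   contains [W n]. *)
have BW n : B `&` W n `<=` P n.
  move=> g [[m _ Pmg] Wng]; have [/Pmono|/ltnW nm] := leqP m n; first exact.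
  elim: m nm Pmg => [|m IHm]; first by rewrite leqn0 => /eqP ->.
  rewrite leq_eqVlt => /predU1P[-> //|nm]; rewrite PS => -[|[b Pb [h Hh bh]]].
    exact: IHm.
  have : (setmul (W (stage_type m)) (H m) `&` W m) g.
    split; last exact: Wmono Wng.
    by exists b; [exact: PW|exists h].
  by rewrite freshH.
exists B; split.
- by exists 0 => //; rewrite P0.
- move=> g [n _]; elim: n => [|n IHn]; first by rewrite P0; right.
  rewrite PS => -[//|]; have [_ DS _ _ _] := adm (stage_type n).
  by move=> /DS; left.
- move=> K finK.
  have [n _ KW] : \forall n \near \oo, (\bigcap_(k in K) [set n | W n k]) n.
    apply: (@filter_finite_bigcap _ _ \oo K (fun k => [set n | W n k]) _ finK) => k _.
    have [n enk] := e_surj k; exists n.+1 => // m /= nm.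
    by apply: (Wmono _ _ nm); rewrite WS; right; rewrite /= enk.
  have {}KW k : K k -> W n k by move=> Kk; apply: (KW n) => //=.
  have [_ _ _ sepD FD] := adm n.
  (* The stages of type [n] are the numbers one below an odd multiple of 2 ^ n. *)
  pose m i := (2 ^ n * i.*2.+1).-1.
  have mS i : (m i).+1 = 2 ^ n * i.*2.+1 by rewrite prednK // muln_gt0 expn_gt0.
  have mtype i : stage_type (m i) = n.
    by rewrite /stage_type mS mulnC logn_Gauss ?pfactorK // coprime2n /= odd_double.
  apply: (Fup _ _ (FD (fun i => j (m i).+1) _)).
    have jmono a b : (a < b)%N -> (j a < j b)%N.
      exact: (homo_ltn ltn_trans jS).
    move=> a b ab; apply: jmono; rewrite !mS.
    by rewrite ltn_pmul2l ?expn_gt0 // ltnS ltn_double.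
  move=> g [i _ Hg] k Kk; set l := m i in Hg.
  have {}Hg : H l g by rewrite /H mtype.
  have tl : stage_type l = n by exact: mtype.
  have kgS : setmul (W n) (H l) (k * g)%g by exists k; [exact: KW|exists g].
  (* The product [kg] lies in the window of stage [l.+1] but not in that of
     stage [l], so it can be a word only if it is created at stage [l]. *)
  split=> [Bkg|Bk].
    have : P l.+1 (k * g)%g.
      by apply: BW; split=> //; rewrite WS; left; right; rewrite tl.
    rewrite PS tl => -[Pkg|[b Pb [h Hh bh]]].
      have : (setmul (W n) (H l) `&` W l) (k * g)%g by split=> //; exact: PW.
      by have := freshH l; rewrite tl => ->.
    have hg : h = g.
      rewrite /H mtype in Hg Hh.
      by apply: (sepD _ _ _ _ _ Hh Hg _ _ bh); [exact: PW|exact: KW].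
    rewrite hg in bh; exists n => //.
    by have /mulIg <- := bh.
  exists l.+1 => //; rewrite PS; right; rewrite tl; exists k; last by exists g.
  by apply: BW; split=> //; exact: KW.
Qed.
End Construction.
End Blocks.

(** * The shift on the cube of boolean functions *)

Section Shift.
Variable G : groupType.

(** Right translation of the argument makes this a left action. *)
Definition shift (g : G) (y : {ptws G -> bool}) : {ptws G -> bool} :=
  fun h => y (h * g)%g.

Lemma cvg_cube (Phi : set_system {ptws G -> bool}) (y : {ptws G -> bool}) :
  Filter Phi -> (forall h, (fun z : {ptws G -> bool} => z h) @ Phi --> y h) ->
  Phi --> y.
Proof.
move=> PhiF Phiy; apply/cvg_sup => h; apply/cvg_image.
  by rewrite predeqE => b; split=> // _; exists (fun=> b).
move=> U Uyh; exists [set z : {ptws G -> bool} | U (z h)]; first exact: Phiy.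
by apply: image_preimage; rewrite predeqE => b; split=> // _; exists (fun=> b).
Qed.

Lemma shift_continuous g : continuous (shift g).
Proof.
move=> y; apply: cvg_cube => h.
exact: (@proj_continuous G (fun _ => bool) (h * g)%g y).
Qed.

Lemma compact_cube : compact [set: {ptws G -> bool}].
Proof.
have := @tychonoff G (fun _ => bool) (fun _ => setT) (fun _ => bool_compact).
by congr compact; rewrite predeqE.
Qed.

Lemma hausdorff_cube : hausdorff_space {ptws G -> bool}.
Proof.
apply: (@hausdorff_product G (fun _ => bool)) => _; exact: discrete_hausdorff.
Qed.

Lemma shift1 y : shift 1%g y = y.
Proof. by apply: funext => h; rewrite /shift mulg1. Qed.

Lemma shiftM g h y : shift (g * h)%g y = shift g (shift h y).
Proof. by apply: funext => k; rewrite /shift mulgA. Qed.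

Definition bernoulli_shift : gsystem G :=
  Gsystem compact_cube hausdorff_cube shift1 shiftM shift_continuous.

(** The sets of return times to the cylinders around [x] generate a filter [R]
    whose sets are in [F], and the orbit of [x] converges to [x] along [R]. *)
Lemma shift_recurrent (F : set_system G) (x : bernoulli_shift) :
  (forall C C', F C -> C `<=` C' -> F C') ->
  (forall K, finite_set K -> F [set g | forall k, K k -> x (k * g)%g = x k]) ->
  recurrent F x.
Proof.
move=> Fup xK V xV; have xVn : nbhs x V by exact: open_nbhs_nbhs.
pose E K : set G := [set g | forall k, K k -> x (k * g)%g = x k].
pose R := filter_from [set K : set G | finite_set K] E.
have RF : Filter R.
  apply: filter_from_filter; first by exists set0; exact: finite_set0.
  move=> K L finK finL; exists (K `|` L); first by rewrite /= finite_setU.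
  by move=> g gE; split=> k Kk; apply: gE; [left|right].
have : (shift^~ x) @ R --> (x : {ptws G -> bool}).
  apply: cvg_cube => h U /= Uxh.
  exists [set h]; first exact: finite_set1.
  move=> g /(_ h erefl) xhg; suff : U (x (h * g)%g) by [].
  by rewrite xhg; exact: nbhs_singleton Uxh.
move=> /(_ V xVn)[K finK KV].
exact: Fup (xK K finK) KV.
Qed.
End Shift.

(** The set [S] and the blocks come from the idempotent [p], and the recurrent
    point is the indicator of the set of words built from them, with the
    cylinder of the functions true at 1 as neighborhood. *)
Lemma essential_contains_return_times (G : groupType) (F : set_system G)
    (A : set G) :
  countable [set: G] -> furstenberg_family F -> property_P1 F -> property_P2 F ->
  essential F A ->
  exists (X : gsystem G) (x : X) (U : set X),
    [/\ recurrent F x, open_nbhs x U & return_times x U `<=` A `|` [set 1%g]].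
Proof.
move=> Gcount [_ Fup] F1 F2 [p [Fp pp pA]]; have Up := ultrafilterP p.
have [S [SA pS Smov]] := @idempotent_star _ _ _ pp pA.
have S1 : right_mover p S 1%g.
  rewrite /right_mover /= ltransVE.
  suff -> : [set h | S (1 * h)%g] = S by [].
  by rewrite predeqE => h /=; rewrite mul1g.
have [e e_surj] := @countable_enumeration _ 1%g Gcount.
have /choice[blocks blocksP] : forall PW : set G * set G, exists D,
    finite_set PW.1 -> PW.1 `<=` right_mover p S -> finite_nonempty PW.2 ->
    admissible_blocks F S PW.1 PW.2 D.
  move=> [P W] /=.
  have [[finP PS finW]|nPW] := pselect
      [/\ finite_set P, P `<=` right_mover p S & finite_nonempty W].
    by have [D admD] := admissible_blocks_exist F1 F2 Fp finP PS finW; exists D.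
  by exists (fun=> set0) => finP PS finW; case: nPW.
have [B [B1 BS Brec]] := @sparse_words_exist G F S (right_mover p S) e
  (fun P W => blocks (P, W)) S1 Smov (fun P W => blocksP (P, W)) e_surj Fup.
pose x : bernoulli_shift G := fun g => `[< B g >].
exists (bernoulli_shift G), x, [set y : bernoulli_shift G | y 1%g]; split.
- apply: shift_recurrent => // K finK.
  apply: Fup (Brec _ finK) _ => g gK k /gK Bkg.
  exact: asbool_equiv_eq.
- split; last by rewrite /= /x; apply/asboolP.
  suff -> : [set y : bernoulli_shift G | y 1%g] =
      @proj G (fun=> bool) 1%g @^-1` [set b | b] by
    apply: open_comp => [y _|]; [exact: proj_continuous|exact: discrete_open].
  by [].
- move=> g; rewrite /return_times /= /shift mul1g => /asboolP/BS[/SA|->].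
    by left.
  by right.
Qed.

Theorem theorem5p7 (G : groupType) (F : set_system G) :
  countable [set: G] -> infinite_set [set: G] ->
  furstenberg_family F -> ramsey_property F ->
  property_P1 F -> property_P2 F ->
  nonempty_closed_subsemigroup (hull F) ->
  (forall (X : gsystem G) (x : X), recurrent F x ->
     forall U : set X, open_nbhs x U -> essential F (return_times x U)) /\
  (forall A : set G, essential F A ->
     exists (X : gsystem G) (x : X) (U : set X),
       [/\ recurrent F x, open_nbhs x U
         & return_times x U `<=` A `|` [set 1%g]]).
Proof.
move=> Gcount _ Ffam FR F1 F2 hullF; split=> [X x xrec U xU|A].
  exact: recurrent_return_essential xrec xU.
exact: essential_contains_return_times.
Qed.
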